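(* For any set $X$, the free left restriction monoid $\mathcal L_X$ has (monoid) presentation $$\operatorname{Mon}\langle A_X\cup X:R_X\cup R_1\cup R_2\rangle$$ via the morphism $\Phi_X:(A_X\cup X)^*\to\mathcal L_X$ determined by $a_w\mapsto(w^{\downarrow},\iota)$ for $w\in X^+$, and $x\mapsto(x^{\downarrow},x)$ for $x\in X$, where $A_X=\{a_w:w\in X^+\}$ is an alphabet in one-one correspondence with $X^+$ (disjoint from $X$), $$R_X=\{(a_wa_v,a_va_w):w,v\in X^+\}\cup\{(a_{wv}a_w,a_{wv}):w\in X^+,\ v\in X^*\},$$ $$R_1=\{(xa_w,a_{xw}x):x\in X,\ w\in X^+\},\qquad R_2=\{(x,a_xx):x\in X\}.$$
   Context: $X^*$ is the free monoid on $X$, $\iota$ the empty word, $X^+=X^*\setminus\{\iota\}$. For $w\in X^*$, $w^{\downarrow}$ is the set of all prefixes of $w$ (including $\iota$ and $w$); for $A\subseteq X^*$, $A^{\downarrow}=\bigcup_{w\in A}w^{\downarrow}$. Let $\mathcal P_X$ be the set of all non-empty, finite, prefix-closed subsets $A=A^{\downarrow}$ of $X^*$. The free left restriction monoid over $X$ is the set $$\mathcal L_X=\{(A,w):A\in\mathcal P_X,\ w\in A\}$$ with product $(A,w)(B,v)=(A\cup wB,wv)$, where $wB=\{wv:v\in B\}$ (and unary operation $(A,w)^+=(A,\iota)$); its identity is $(\{\iota\},\iota)$. A monoid $T$ has presentation $\operatorname{Mon}\langle Z:R\rangle$ via $\phi$ if $\phi:Z^*\to T$ is a surjective monoid morphism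 whose kernel is the congruence on $Z^*$ generated by $R\subseteq Z^*\times Z^*$. *)

(* Defs.v *)
From HB Require Import structures.
From mathcomp Require Import all_boot.
From mathcomp Require Import boolp classical_sets cardinality.

Set Implicit Arguments.
Unset Strict Implicit.
Unset Printing Implicit Defensive.

Local Open Scope classical_set_scope.
Local Open Scope group_scope.

(* [word Z] is the free monoid Z^*: the product is concatenation and 1 is the
   empty word.  A [monoidType] carries an [eqType] and a [choiceType] structure;
   they are obtained classically, so that [Z] may be an arbitrary type. *)
Definition word (Z : Type) : Type := seq Z.

HB.instance Definition _ (Z : Type) := gen_eqMixin (word Z).
HB.instance Definition _ (Z : Type) := gen_choiceMixin (word Z).
HB.instance Definition _ (Z : Type) :=
  isMonoid.Build (word Z) (@catA Z) (@cat0s Z) (@cats0 Z).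

Definition letter (Z : Type) (z : Z) : word Z := [:: z].

Definition congruence (M : monoidType) (e : M -> M -> Prop) : Prop :=
  [/\ (forall u, e u u),
      (forall u v, e u v -> e v u),
      (forall u v w, e u v -> e v w -> e u w) &
      (forall u u' v v', e u u' -> e v v' -> e (u * v) (u' * v'))].

(* The least congruence containing [R]. *)
Definition congruence_generated (M : monoidType) (R : set (M * M)) (u v : M) :
    Prop :=
  forall e : M -> M -> Prop,
    congruence e -> (forall p, R p -> e p.1 p.2) -> e u v.

Definition has_presentation_via (Z : Type) (R : set (word Z * word Z))
    (T : monoidType) (phi : word Z -> T) : Prop :=
  [/\ monoid_morphism phi,
      (forall t : T, exists u : word Z, phi u = t) &
      (forall u v : word Z, phi u = phi v <-> congruence_generated R u v)].

Section FreeLeftRestrictionMonoid.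
Variable X : Type.
Implicit Types (w v u : word X) (A B : set (word X)).

Definition prefixes w : set (word X) := [set u | exists v, w = u * v].

Definition prefix_closure A : set (word X) := \bigcup_(w in A) prefixes w.

Definition calP : set (set (word X)) :=
  [set A | [/\ A !=set0, finite_set A & A = prefix_closure A]].

Definition translate w B : set (word X) := [set w * v | v in B].

Record freeLR : Type := FreeLR {
  lset : set (word X);
  lword : word X;
  lset_calP : calP lset;
  lword_in : lset lword
}.

Lemma freeLR_eq (s t : freeLR) : lset s = lset t -> lword s = lword t -> s = t.
Proof.
case: s t => [A w hA hw] [B v hB hv] /= eAB ewv; subst B v.
by rewrite (Prop_irrelevance hA hB) (Prop_irrelevance hw hv).
Qed.

Lemma prefix_closureP A :
  A = prefix_closure A <-> (forall u v, A (u * v) -> A u).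
Proof.
split=> [-> u v [w Aw [t wE]]|h].
  by exists w => //; exists (v * t); rewrite wE mulgA.
apply/seteqP; split=> [u Au|u [w Aw [v wE]]].
  by exists u => //; exists 1; rewrite mulg1.
by apply: (h u v); rewrite -wE.
Qed.

Lemma prefixes_refl w : prefixes w w.
Proof. by exists 1; rewrite mulg1. Qed.

Lemma prefixes1 w : prefixes w 1.
Proof. by exists w; rewrite mul1g. Qed.

Lemma finite_prefixes w : finite_set (prefixes w).
Proof.
apply: (@sub_finite_set _ _ ((fun n => take n w : word X) @` `I_(size w).+1)).
  move=> u [v ->]; exists (size u); last by rewrite take_size_cat.
  by rewrite /= ltnS size_cat leq_addr.
exact/finite_image/finite_II.
Qed.

Lemma prefixes_calP w : calP (prefixes w).
Proof.
split; [by exists w; apply: prefixes_refl | exact: finite_prefixes |].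
by apply/prefix_closureP=> u v [t ->]; exists (v * t); rewrite mulgA.
Qed.

Lemma cat_eq_cat (a b c d : word X) : a * b = c * d ->
  (exists t, a = c * t) \/ (exists2 t, c = a * t & b = t * d).
Proof.
elim: a c => [|x a IH] [|y c] e.
- by left; exists 1.
- by right; exists (y :: c).
- by left; exists (x :: a).
case: e => -> /IH [[t ->]|[t -> ->]]; first by left; exists t.
by right; exists t.
Qed.

Lemma calP_mul A B w : calP A -> A w -> calP B -> calP (A `|` translate w B).
Proof.
move=> [A0 fA /prefix_closureP cA] Aw [B0 fB /prefix_closureP cB]; split.
- by exists w; left.
- by rewrite finite_setU; split=> //; apply: finite_image.
apply/prefix_closureP=> u v [/cA|[t Bt]]; first by left.
move=> /cat_eq_cat [[s wE]|[s -> tE]].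
  by left; apply: (cA u s); rewrite -wE.
by right; exists s => //; apply: (cB s v); rewrite -tE.
Qed.

Lemma calP_has1 A : calP A -> A 1.
Proof.
by move=> [[w Aw] _ /prefix_closureP cA]; apply: (cA 1 w); rewrite mul1g.
Qed.

Lemma freeLR_mul_in (s t : freeLR) :
  (lset s `|` translate (lword s) (lset t)) (lword s * lword t).
Proof. by right; exists (lword t) => //; apply: lword_in. Qed.

(* (A, w)(B, v) = (A \cup wB, wv) *)
Definition freeLR_mul (s t : freeLR) : freeLR :=
  FreeLR (calP_mul (lset_calP s) (lword_in s) (lset_calP t))
         (freeLR_mul_in s t).

Lemma calP1 : calP [set 1].
Proof.
split; [by exists 1 | exact: finite_set1 |].
by apply/prefix_closureP=> -[|x u] v // /(congr1 size).
Qed.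

Definition freeLR_one : freeLR := @FreeLR [set 1] 1 calP1 erefl.

Lemma freeLR_mulA : associative freeLR_mul.
Proof.
move=> r s t; apply: freeLR_eq => /=; last by rewrite mulgA.
rewrite /translate image_setU setUA; congr (_ `|` _).
by rewrite image_comp; apply: eq_imagel => u _ /=; rewrite mulgA.
Qed.

Lemma freeLR_mul1 : left_id freeLR_one freeLR_mul.
Proof.
move=> s; apply: freeLR_eq => /=; last by rewrite mul1g.
apply/seteqP; split=> [u [->|[v sv <-]]|u su].
- exact: calP_has1 (lset_calP s).
- by rewrite mul1g.
- by right; exists u => //; rewrite mul1g.
Qed.

Lemma freeLR_mulr1 : right_id freeLR_one freeLR_mul.
Proof.
move=> s; apply: freeLR_eq => /=; last by rewrite mulg1.
apply/seteqP; split=> [u [//|[v -> <-]]|u su]; last by left.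
by rewrite mulg1; apply: lword_in.
Qed.

HB.instance Definition _ := gen_eqMixin freeLR.
HB.instance Definition _ := gen_choiceMixin freeLR.
HB.instance Definition _ :=
  isMonoid.Build freeLR freeLR_mulA freeLR_mul1 freeLR_mulr1.

(* X^+ *)
Definition plus_word : Type := {w : word X | w <> 1}.

Lemma plus_word_mulr_neq1 (w : plus_word) v : sval w * v <> 1.
Proof. by case: w => -[|x w] // []. Qed.

Lemma letter_mul_neq1 (x : X) v : letter x * v <> 1.
Proof. by []. Qed.

Lemma letter_neq1 (x : X) : letter x <> 1.
Proof. by []. Qed.

Definition plus_mulr (w : plus_word) v : plus_word :=
  exist _ (sval w * v) (@plus_word_mulr_neq1 w v).

Definition plus_cons (x : X) (w : plus_word) : plus_word :=
  exist _ (letter x * sval w) (@letter_mul_neq1 x (sval w)).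

Definition plus_letter (x : X) : plus_word :=
  exist _ (letter x) (@letter_neq1 x).

(* The alphabet A_X \cup X: [gen_a w] is a_w. *)
Inductive alphabet : Type :=
| gen_a of plus_word
| gen_x of X.

Local Notation a_ w := (letter (gen_a w)).
Local Notation x_ x := (letter (gen_x x)).

Definition RX : set (word alphabet * word alphabet) :=
  [set p | exists w v : plus_word, p = (a_ w * a_ v, a_ v * a_ w)] `|`
  [set p | exists (w : plus_word) (v : word X),
     p = (a_ (plus_mulr w v) * a_ w, a_ (plus_mulr w v))].

Definition R1 : set (word alphabet * word alphabet) :=
  [set p | exists (x : X) (w : plus_word),
     p = (x_ x * a_ w, a_ (plus_cons x w) * x_ x)].

Definition R2 : set (word alphabet * word alphabet) :=
  [set p | exists x : X, p = (x_ x, a_ (plus_letter x) * x_ x)].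

Definition Phi_gen (z : alphabet) : freeLR :=
  match z with
  | gen_a w => FreeLR (prefixes_calP (sval w)) (prefixes1 (sval w))
  | gen_x x => FreeLR (prefixes_calP (letter x)) (prefixes_refl (letter x))
  end.

Definition Phi (s : word alphabet) : freeLR :=
  \big[*%g/1]_(z <- s) Phi_gen z.

End FreeLeftRestrictionMonoid.

(* Main.v *)
Require Import Defs.
From HB Require Import structures.
From mathcomp Require Import all_boot.
From mathcomp Require Import boolp classical_sets cardinality.
From Stdlib Require Import Setoid Morphisms.

(** Write [abar w] for the generator [a_w] when [w] is nonempty and for the
    empty word when [w] is empty, and let [x] range over letters.  The relations
    then take a uniform shape: the elements [abar w] commute, [abar w] absorbs
    [abar p] for every prefix [p] of [w], and [x abar(w) = abar(xw) x] for every
    word [w], the case of the empty word being the relation [x = a_x x].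

    The morphism sends [abar w] to the idempotent with set component the
    prefixes of [w], so products of [abar]s encode finite prefix-closed sets by
    finite lists of generators of these sets, and commutation and absorption
    are exactly what is needed to identify two lists with the same prefix
    closure ([idem_prod_eqv]).

    The relations [x abar(w) = abar(xw) x] let every letter move to the right of
    all the [abar]s, so that each word over the alphabet is equivalent to
    [abar(w_1) ... abar(w_n) x_1 ... x_m] ([normal_form]).  Starting the
    process from a list containing the empty word keeps [x_1 ... x_m] among the
    [w_i].  The image of such a normal form is then
    (prefix closure of the [w_i], [x_1 ... x_m]), as computed in
    [lset_Phi_normal] and [lword_Phi_normal]: this gives surjectivity, since a
    prefix-closed finite set is the closure of the list of its elements, and it
    shows that two normal forms with equal images have the same letters and
    lists with the same closure, hence are equivalent. *)

Set Implicit Arguments.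
Unset Strict Implicit.
Unset Printing Implicit Defensive.

Local Open Scope classical_set_scope.
Local Open Scope group_scope.

(** * Generated congruences and prefixes *)

Section GeneratedCongruence.
Variables (M : monoidType) (R : set (M * M)).

Lemma congruence_generated_congruence : congruence (congruence_generated R).
Proof.
split=> [u e [er _ _ _] _|u v uv e ce Re|u v w uv vw e ce Re
        |u u' v v' uu' vv' e ce Re]; first exact: er.
- by case: (ce) => _ es _ _; apply: es; apply: uv.
- by case: (ce) => _ _ et _; apply: (et _ v); [apply: uv | apply: vw].
- by case: (ce) => _ _ _ em; apply: em; [apply: uu' | apply: vv'].
Qed.

Lemma congruence_generated_sub u v : R (u, v) -> congruence_generated R u v.
Proof. by move=> Ruv e _ Re; apply: (Re (u, v)). Qed.

#[global] Instance congruence_generated_equiv :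
  Equivalence (congruence_generated R).
Proof. by case: congruence_generated_congruence. Qed.

#[global] Instance congruence_generated_mul :
  Proper (congruence_generated R ==> congruence_generated R ==>
          congruence_generated R) (@mul M).
Proof.
by case: congruence_generated_congruence => _ _ _ em u u' uu' v v'; apply: em.
Qed.

Lemma congruence_generated_refl u : congruence_generated R u u.
Proof. reflexivity. Qed.

End GeneratedCongruence.

#[local] Hint Resolve congruence_generated_refl : core.

Lemma kernel_congruence (M N : monoidType) (f : M -> N) :
  monoid_morphism f -> congruence (fun u v => f u = f v).
Proof.
move=> [_ fM]; split=> // [u v w -> //|u u' v v' uu' vv'].
by rewrite !fM uu' vv'.
Qed.

Section Prefixes.
Variable X : Type.
Implicit Types (w v u : word X) (A : set (word X)).

Lemma translate1 A : translate 1 A = A.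
Proof.
apply/seteqP; split=> [u [v Av <-]|u Au]; first by rewrite mul1g.
by exists u => //; rewrite mul1g.
Qed.

Lemma prefixes_one : prefixes (1 : word X) = [set 1].
Proof.
apply/seteqP; split=> [[//|x u] [v]|u ->] //; exact: prefixes_refl.
Qed.

Lemma prefixes_mul w v :
  prefixes (w * v) = prefixes w `|` translate w (prefixes v).
Proof.
apply/seteqP; split=> [u [t /cat_eq_cat[]]|u [[t ->]|[p [t ->] <-]]].
- by move=> [s ws]; left; exists s.
- by move=> [s -> ->]; right; exists s => //; exists t.
- by exists (t * v); rewrite mulgA.
- by exists t; rewrite mulgA.
Qed.

Lemma prefixes_absorb w v : prefixes w `|` prefixes (w * v) = prefixes (w * v).
Proof. by rewrite prefixes_mul setUA setUid. Qed.

End Prefixes.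

(** * Words in the generators *)

Section Presentation.
Variable X : Type.
Implicit Types (w v : word X) (W : seq (word X)).

Local Notation a_ w := (letter (gen_a w)).
Local Notation x_ x := (letter (gen_x x)).
Local Notation "u ~= v" :=
  (congruence_generated (@RX X `|` @R1 X `|` @R2 X) u v) (at level 70).

(** The generator [a_w], extended by [1] at the empty word: with this convention
    the relations hold for all words and need no separate case. *)
Definition abar w : word (alphabet X) :=
  match w with
  | [::] => 1
  | x :: v => a_ (exist _ (letter x * v) (@letter_mul_neq1 X x v))
  end.

Lemma abar_sval (p : plus_word X) : abar (sval p) = a_ p.
Proof.
case: p => -[|x w] p //=; congr (letter (gen_a _)); exact: eq_exist.
Qed.

Lemma abarE w : w <> 1 -> exists p : plus_word X, w = sval p.
Proof. by move=> w1; exists (exist _ w w1). Qed.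

Definition idem_prod W : word (alphabet X) := \prod_(w <- W) abar w.

Definition letters w : word (alphabet X) := map (@gen_x X) w.

Lemma abar_comm w v : abar w * abar v ~= abar v * abar w.
Proof.
have [->|/abarE[p ->]] := pselect (w = 1); first by rewrite mul1g mulg1.
have [->|/abarE[q ->]] := pselect (v = 1); first by rewrite mul1g mulg1.
rewrite !abar_sval; apply: congruence_generated_sub.
by left; left; left; exists p, q.
Qed.

Lemma abar_absorb w v : abar (w * v) * abar w ~= abar (w * v).
Proof.
have [->|/abarE[p ->]] := pselect (w = 1); first by rewrite mulg1.
have -> : sval p * v = sval (plus_mulr p v) by [].
rewrite !abar_sval; apply: congruence_generated_sub.
by left; left; right; exists p, v.
Qed.

Lemma abar_letter (x : X) w : x_ x * abar w ~= abar (letter x * w) * x_ x.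
Proof.
have [->|/abarE[p ->]] := pselect (w = 1).
  rewrite !mulg1 (abar_sval (plus_letter x)).
  by apply: congruence_generated_sub; right; exists x.
have -> : letter x * sval p = sval (plus_cons x p) by [].
rewrite !abar_sval; apply: congruence_generated_sub.
by left; right; exists x, p.
Qed.

Lemma idem_prod_cons w W : idem_prod (w :: W) = abar w * idem_prod W.
Proof. exact: big_cons. Qed.

Lemma idem_prod_comm1 w W : abar w * idem_prod W ~= idem_prod W * abar w.
Proof.
elim: W => [|v W IH]; first by rewrite /idem_prod big_nil mul1g mulg1.
by rewrite idem_prod_cons mulgA abar_comm -mulgA IH mulgA.
Qed.

Lemma idem_prod_comm W V :
  idem_prod W * idem_prod V ~= idem_prod V * idem_prod W.
Proof.
elim: W => [|w W IH]; first by rewrite /idem_prod big_nil mul1g mulg1.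
by rewrite idem_prod_cons -mulgA IH mulgA (idem_prod_comm1 w V) -mulgA.
Qed.

Lemma idem_prod_absorb1 W u :
  prefix_closure [set` W] u -> idem_prod W * abar u ~= idem_prod W.
Proof.
elim: W => [|w W IH] [v /=]; first by [].
rewrite in_cons => /orP[/eqP-> [t ->]|vW uv].
  by rewrite idem_prod_cons -mulgA -idem_prod_comm1 mulgA abar_absorb.
by rewrite idem_prod_cons -mulgA IH //; exists v.
Qed.

Lemma idem_prod_absorb W V :
  [set` V] `<=` prefix_closure [set` W] ->
  idem_prod W * idem_prod V ~= idem_prod W.
Proof.
elim: V => [_|v V IH VW]; first by rewrite /idem_prod big_nil mulg1.
rewrite idem_prod_cons mulgA idem_prod_absorb1; last first.
  by apply: VW; rewrite /= mem_head.
by apply: IH => u Vu; apply: VW; rewrite /= in_cons Vu orbT.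
Qed.

(** Each of the two products absorbs the other one, and they commute. *)
Lemma idem_prod_eqv W V :
  prefix_closure [set` W] = prefix_closure [set` V] ->
  idem_prod W ~= idem_prod V.
Proof.
have sub_closure U : [set` U] `<=` prefix_closure [set` U].
  by move=> u Uu; exists u => //; apply: prefixes_refl.
move=> WV; rewrite -(@idem_prod_absorb W V); last first.
  by rewrite WV; apply: sub_closure.
rewrite idem_prod_comm idem_prod_absorb //.
by rewrite -WV; apply: sub_closure.
Qed.

Lemma letter_idem_prod (x : X) W :
  x_ x * idem_prod W ~= idem_prod [seq letter x * w | w <- W] * x_ x.
Proof.
elim: W => [|w W IH]; first by rewrite /idem_prod !big_nil mul1g mulg1.
by rewrite /= !idem_prod_cons mulgA abar_letter -mulgA IH mulgA.
Qed.

(** The condition [v \in W] makes the list alone determine the set component of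
    the image.  It survives multiplication by a letter on the left, which acts
    on [v] and on the members of [W] in the same way. *)
Lemma normal_form (u : word (alphabet X)) :
  exists W v, v \in W /\ u ~= idem_prod W * letters v.
Proof.
elim: u => [|[p|x] u [W [v [vW uE]]]].
- (* [abar 1 = 1], so the list may contain the empty word from the start *)
  exists [:: 1], 1; rewrite mem_head /idem_prod big_seq1 mul1g.
  by split.
- exists (sval p :: W), v; rewrite in_cons vW orbT; split=> //.
  have -> : gen_a p :: u = a_ p * u by [].
  by rewrite uE mulgA idem_prod_cons abar_sval.
- exists [seq letter x * w | w <- W], (letter x * v).
  split; first by apply/mapP; exists v.
  have -> : gen_x x :: u = x_ x * u by [].
  have -> : letters (letter x * v) = x_ x * letters v by [].
  by rewrite uE mulgA letter_idem_prod -mulgA.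
Qed.

(** * The images of words in the free left restriction monoid *)

Lemma Phi_morphism : monoid_morphism (@Phi X).
Proof. by split=> [|u v]; rewrite /Phi ?big_nil ?big_cat. Qed.

Lemma Phi_mul (u v : word (alphabet X)) : Phi (u * v) = Phi u * Phi v.
Proof. by case: Phi_morphism => _; apply. Qed.

Lemma Phi_letter (z : alphabet X) : Phi (letter z) = Phi_gen z.
Proof. exact: big_seq1. Qed.

Lemma lset_mul (s t : freeLR X) :
  lset (s * t) = lset s `|` translate (lword s) (lset t).
Proof. by []. Qed.

Lemma lword_mul (s t : freeLR X) : lword (s * t) = lword s * lword t.
Proof. by []. Qed.

Lemma Phi_abar w : lset (Phi (abar w)) = prefixes w /\ lword (Phi (abar w)) = 1.
Proof.
have [->|/abarE[p ->]] := pselect (w = 1).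
  by rewrite /Phi big_nil prefixes_one.
by rewrite abar_sval Phi_letter.
Qed.

Lemma Phi_letters w :
  lset (Phi (letters w)) = prefixes w /\ lword (Phi (letters w)) = w.
Proof.
elim: w => [|x w [IHs IHw]]; first by rewrite /Phi big_nil prefixes_one.
have -> : letters (x :: w) = x_ x * letters w by [].
by rewrite Phi_mul Phi_letter lset_mul lword_mul IHs IHw -prefixes_mul.
Qed.

Lemma lword_Phi_idem_prod W : lword (Phi (idem_prod W)) = 1.
Proof.
elim: W => [|w W IH]; first by rewrite /idem_prod big_nil /Phi big_nil.
by rewrite idem_prod_cons Phi_mul lword_mul IH (Phi_abar w).2 mul1g.
Qed.

(** The singleton is there for the empty list, whose product is the identity
    while its prefix closure is empty. *)
Lemma lset_Phi_idem_prod W :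
  lset (Phi (idem_prod W)) = prefix_closure [set` W] `|` [set 1].
Proof.
rewrite /prefix_closure bigcup_seq; elim: W => [|w W IH].
  by rewrite /idem_prod !big_nil /Phi big_nil set0U.
rewrite idem_prod_cons Phi_mul lset_mul IH (Phi_abar w).1 (Phi_abar w).2.
by rewrite translate1 big_cons setUA.
Qed.

Lemma lword_Phi_normal W v : lword (Phi (idem_prod W * letters v)) = v.
Proof.
by rewrite Phi_mul lword_mul lword_Phi_idem_prod mul1g (Phi_letters v).2.
Qed.

Lemma lset_Phi_normal W v : v \in W ->
  lset (Phi (idem_prod W * letters v)) = prefix_closure [set` W].
Proof.
move=> vW; rewrite Phi_mul lset_mul lset_Phi_idem_prod lword_Phi_idem_prod.
rewrite translate1 (Phi_letters v).1 -setUA; apply/setUidPl.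
move=> u [->|uv]; exists v => //; exact: prefixes1.
Qed.

Lemma Phi_surjective (t : freeLR X) : exists u, Phi u = t.
Proof.
have [_ /finite_seqP[W AW] Aclosed] := lset_calP t.
have wW : lword t \in W by have := lword_in t; rewrite AW.
exists (idem_prod W * letters (lword t)); apply: freeLR_eq.
  by rewrite lset_Phi_normal // -AW -Aclosed.
exact: lword_Phi_normal.
Qed.

Lemma Phi_relations p : (@RX X `|` @R1 X `|` @R2 X) p -> Phi p.1 = Phi p.2.
Proof.
move=> [[[[w [v ->]]|[w [v ->]]]|[x [w ->]]]|[x ->]] /=;
  rewrite ?Phi_mul !Phi_letter; apply: freeLR_eq;
  rewrite ?lset_mul ?lword_mul /= ?translate1 ?mulg1 ?mul1g //.
- exact: setUC.
- by rewrite setUC prefixes_absorb.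
- by rewrite -prefixes_mul setUC prefixes_absorb.
- by rewrite setUid.
Qed.

Lemma Phi_sound (u v : word (alphabet X)) : u ~= v -> Phi u = Phi v.
Proof.
by move=> uv; exact: uv _ (kernel_congruence Phi_morphism) Phi_relations.
Qed.

Lemma Phi_complete (u v : word (alphabet X)) : Phi u = Phi v -> u ~= v.
Proof.
have [W [w [wW uE]]] := normal_form u; have [V [z [zV vE]]] := normal_form v.
rewrite (Phi_sound uE) (Phi_sound vE) => Phi_eq.
have wz : w = z.
  by rewrite -(lword_Phi_normal W w) Phi_eq lword_Phi_normal.
have WV : idem_prod W ~= idem_prod V.
  by apply: idem_prod_eqv; rewrite -(lset_Phi_normal wW) Phi_eq lset_Phi_normal.
by rewrite uE vE WV wz.
Qed.

End Presentation.

Theorem theorem7p13 (X : Type) :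
  has_presentation_via (@RX X `|` @R1 X `|` @R2 X) (@Phi X).
Proof.
split; [exact: Phi_morphism | exact: Phi_surjective |].
by move=> u v; split; [apply: Phi_complete | apply: Phi_sound].
Qed.
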